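(* Let $b=b_1\mathbf i+b_2\mathbf j+b_3\mathbf k\neq0$ and $c=c_0+c_1\mathbf i+c_2\mathbf j+c_3\mathbf k\in\mathbb H_s$. The equation $x^2+bx+c=0$ has a solution $x=x_0+x_1\mathbf i+x_2\mathbf j+x_3\mathbf k\in\mathbb H_s$ with $2x_0+b\in Z(\mathbb H_s)$ if and only if the following condition (Condition A) holds: $M_b\ge0$, $M_c\ge 0$, and (A1) there exists $r\in\mathbb R$ with $r^2=\frac{M_b}{4}$ satisfying $(b_2c_3-b_3c_2)r-b_1(b_2c_2+b_3c_3)+c_1(b_2^2+b_3^2)=0$; (A2) if $b_3c_2=b_2c_3$, then $c_0(b_2^2+b_3^2)+c_2^2+c_3^2=0$. If Condition A holds with $r$, put $$a_{21}=\frac{-2r^2b_2-(b_1b_3+2c_2)r-b_1c_3}{b_2^2+b_3^2},\quad a_{22}=\frac{b_1b_2-2b_3r}{b_2^2+b_3^2},$$ $$a_{31}=\frac{-2r^2b_3+(b_1b_2-2c_3)r+b_1c_2}{b_2^2+b_3^2},\quad a_{32}=\frac{b_1b_3+2b_2r}{b_2^2+b_3^2}.$$ Then: (1) If $b_3c_2-b_2c_3\ne0$, the equation has solutions $x=r+x_1\mathbf i+x_2\mathbf j+x_3\mathbf k$, where $$r=\frac{b_1(b_2c_2+b_3c_3)-c_1(b_2^2+b_3^2)}{b_2c_3-b_3c_2},\quad x_1=\frac{c_0(b_2^2+b_3^2)+b_1(b_3c_2-b_2c_3)+c_2^2+c_3^2}{2(b_2c_3-b_3c_2)},$$ $x_2=a_{21}+a_{22}x_1$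 and $x_3=a_{31}+a_{32}x_1$. (2) If $b_3c_2-b_2c_3=0$, the equation has the solutions $x=r+x_1\mathbf i+(a_{21}+a_{22}x_1)\mathbf j+(a_{31}+a_{32}x_1)\mathbf k$ for all $x_1\in\mathbb R$, where $a_{21},a_{22},a_{31},a_{32}$ are given by the formulas above with $r=\frac{\sqrt{M_b}}2$ or $r=-\frac{\sqrt{M_b}}2$.
   Context: $\mathbb H_s$ is the split quaternion algebra: the 4-dimensional associative real algebra with basis $1,\mathbf i,\mathbf j,\mathbf k$ and $\mathbf i^2=-1$, $\mathbf j^2=\mathbf k^2=1$, $\mathbf i\mathbf j=\mathbf k=-\mathbf j\mathbf i$, $\mathbf j\mathbf k=-\mathbf i=-\mathbf k\mathbf j$, $\mathbf k\mathbf i=\mathbf j=-\mathbf i\mathbf k$. For $x=x_0+x_1\mathbf i+x_2\mathbf j+x_3\mathbf k$ ($x_i\in\mathbb R$): $I_x=x_0^2+x_1^2-x_2^2-x_3^2$ and $M_x=-x_1^2+x_2^2+x_3^2$. $Z(\mathbb H_s)=\{x\in\mathbb H_s:I_x=0\}$.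
   Formalization: A missing factor 2 is restored: (A1) reads 2(b2c3-b3c2)r - b1(b2c2+b3c3) + c1(b2^2+b3^2) = 0, and in (1) the denominator of r is 2(b2c3-b3c2). As printed the claim fails for b=j, c=-i+k, x=(1+i-j-k)/2. *)

(* Defs.v *)
From HB Require Import structures.
From mathcomp Require Import all_boot all_order all_algebra.
From mathcomp Require Import reals.
From mathcomp Require Import ring.

Set Implicit Arguments.
Unset Strict Implicit.
Unset Printing Implicit Defensive.

Import Order.TTheory GRing.Theory Num.Theory.

Local Open Scope ring_scope.

(* [SplitQ x0 x1 x2 x3] is x0 + x1 i + x2 j + x3 k, see [splitqE] below. *)
Record splitq (R : Type) : Type :=
  SplitQ { sq0 : R ; sq1 : R ; sq2 : R ; sq3 : R }.

Section SplitQuaternionAlgebra.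

Definition splitq_to_prod (R : Type) (x : splitq R) : R * R * R * R :=
  (sq0 x, sq1 x, sq2 x, sq3 x).
Definition splitq_of_prod (R : Type) (p : R * R * R * R) : splitq R :=
  SplitQ p.1.1.1 p.1.1.2 p.1.2 p.2.
Lemma splitq_to_prodK (R : Type) :
  cancel (@splitq_to_prod R) (@splitq_of_prod R).
Proof. by case. Qed.

HB.instance Definition _ (R : choiceType) :=
  Choice.copy (splitq R) (can_type (@splitq_to_prodK R)).

Section Zmod.
Variable R : zmodType.
Implicit Types x y z : splitq R.

Definition splitq_zero : splitq R := SplitQ 0 0 0 0.
Definition splitq_opp x : splitq R :=
  SplitQ (- sq0 x) (- sq1 x) (- sq2 x) (- sq3 x).
Definition splitq_add x y : splitq R :=
  SplitQ (sq0 x + sq0 y) (sq1 x + sq1 y) (sq2 x + sq2 y) (sq3 x + sq3 y).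

Fact splitq_addA : associative splitq_add.
Proof. by move=> x y z; congr SplitQ; rewrite /= addrA. Qed.
Fact splitq_addC : commutative splitq_add.
Proof. by move=> x y; congr SplitQ; rewrite /= addrC. Qed.
Fact splitq_add0 : left_id splitq_zero splitq_add.
Proof. by case=> *; congr SplitQ; rewrite /= add0r. Qed.
Fact splitq_addN : left_inverse splitq_zero splitq_opp splitq_add.
Proof. by case=> *; congr SplitQ; rewrite /= addNr. Qed.

HB.instance Definition _ := GRing.isZmodule.Build (splitq R)
  splitq_addA splitq_addC splitq_add0 splitq_addN.
End Zmod.

Section Alg.
Variable R : comNzRingType.
Implicit Types (x y z : splitq R) (t : R).

Definition splitq_one : splitq R := SplitQ 1 0 0 0.

(* Bilinear extension of i^2 = -1, j^2 = k^2 = 1, ij = k = -ji,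
   jk = -i = -kj, ki = j = -ik; see [splitq_table]. *)
Definition splitq_mul x y : splitq R :=
  let: SplitQ x0 x1 x2 x3 := x in
  let: SplitQ y0 y1 y2 y3 := y in
  SplitQ (x0 * y0 - x1 * y1 + x2 * y2 + x3 * y3)
         (x0 * y1 + x1 * y0 - x2 * y3 + x3 * y2)
         (x0 * y2 + x2 * y0 + x3 * y1 - x1 * y3)
         (x0 * y3 + x3 * y0 + x1 * y2 - x2 * y1).

Definition splitq_scale t x : splitq R :=
  SplitQ (t * sq0 x) (t * sq1 x) (t * sq2 x) (t * sq3 x).

Fact splitq_mulA : associative splitq_mul.
Proof. by move=> [????] [????] [????]; congr SplitQ; ring. Qed.
Fact splitq_mul1 : left_id splitq_one splitq_mul.
Proof. by move=> [????]; congr SplitQ; ring. Qed.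
Fact splitq_mulr1 : right_id splitq_one splitq_mul.
Proof. by move=> [????]; congr SplitQ; ring. Qed.
Fact splitq_mulDl : left_distributive splitq_mul +%R.
Proof. by move=> [????] [????] [????]; congr SplitQ; rewrite /=; ring. Qed.
Fact splitq_mulDr : right_distributive splitq_mul +%R.
Proof. by move=> [????] [????] [????]; congr SplitQ; rewrite /=; ring. Qed.
Fact splitq_one_neq0 : splitq_one != 0.
Proof. by apply/eqP=> -[/eqP]; rewrite oner_eq0. Qed.

HB.instance Definition _ := GRing.Zmodule_isNzRing.Build (splitq R)
  splitq_mulA splitq_mul1 splitq_mulr1 splitq_mulDl splitq_mulDr
  splitq_one_neq0.

Fact splitq_scaleA s t x :
  splitq_scale s (splitq_scale t x) = splitq_scale (s * t) x.
Proof. by congr SplitQ; rewrite /= mulrA. Qed.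
Fact splitq_scale1 : left_id 1 splitq_scale.
Proof. by case=> *; congr SplitQ; rewrite /= mul1r. Qed.
Fact splitq_scaleDr : right_distributive splitq_scale +%R.
Proof. by move=> t x y; congr SplitQ; rewrite /= mulrDr. Qed.
Fact splitq_scaleDl x : {morph splitq_scale^~ x : s t / s + t}.
Proof. by move=> s t; congr SplitQ; rewrite /= mulrDl. Qed.

HB.instance Definition _ := GRing.Zmodule_isLmodule.Build R (splitq R)
  splitq_scaleA splitq_scale1 splitq_scaleDr splitq_scaleDl.

Fact splitq_scaleAl t x y : t *: (x * y) = (t *: x) * y.
Proof. by case: x y => [????] [????]; congr SplitQ; rewrite /=; ring. Qed.
HB.instance Definition _ :=
  GRing.Lmodule_isLalgebra.Build R (splitq R) splitq_scaleAl.

Fact splitq_scaleAr t x y : t *: (x * y) = x * (t *: y).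
Proof. by case: x y => [????] [????]; congr SplitQ; rewrite /=; ring. Qed.
HB.instance Definition _ :=
  GRing.Lalgebra_isAlgebra.Build R (splitq R) splitq_scaleAr.

Definition sqi : splitq R := SplitQ 0 1 0 0.
Definition sqj : splitq R := SplitQ 0 0 1 0.
Definition sqk : splitq R := SplitQ 0 0 0 1.

Lemma splitqE (x0 x1 x2 x3 : R) :
  SplitQ x0 x1 x2 x3 = x0%:A + x1 *: sqi + x2 *: sqj + x3 *: sqk.
Proof. by congr SplitQ; rewrite /=; ring. Qed.

Lemma splitq_table :
  [/\ sqi ^+ 2 = -1, sqj ^+ 2 = 1 & sqk ^+ 2 = 1] /\
  [/\ sqi * sqj = sqk, sqj * sqi = - sqk, sqj * sqk = - sqi,
      sqk * sqj = sqi & sqk * sqi = sqj /\ sqi * sqk = - sqj].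
Proof. by repeat split; congr SplitQ; rewrite /=; ring. Qed.

End Alg.

End SplitQuaternionAlgebra.

Section QuadraticEquation.
Variable R : realType.
Implicit Types (b c x : splitq R) (r : R).

Definition splitq_I x : R :=
  let: SplitQ x0 x1 x2 x3 := x in x0 ^+ 2 + x1 ^+ 2 - x2 ^+ 2 - x3 ^+ 2.

Definition splitq_M x : R :=
  let: SplitQ x0 x1 x2 x3 := x in - x1 ^+ 2 + x2 ^+ 2 + x3 ^+ 2.

Definition splitq_Z : {pred splitq R} := [pred x | splitq_I x == 0].

(* Solvability of the linear system satisfied by (x1, x2, x3) when x0 = r. The
   coefficient of r is 2 (b2 c3 - b3 c2): with x2 = a21 + a22 x1 and
   x3 = a31 + a32 x1, the i-component of the equation is this condition divided
   by b2^2 + b3^2. The source prints this equation, and [root_r], without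
   the factor 2; in that form the solvability criterion fails, for instance for
   b = j and c = - i + k, where x = (1 + i - j - k) / 2 is a solution. *)
Definition condA1 b c r : Prop :=
  let: SplitQ _ b1 b2 b3 := b in
  let: SplitQ c0 c1 c2 c3 := c in
  r ^+ 2 = splitq_M b / 4 /\
  2 * (b2 * c3 - b3 * c2) * r - b1 * (b2 * c2 + b3 * c3)
    + c1 * (b2 ^+ 2 + b3 ^+ 2) = 0.

Definition condA2 b c : Prop :=
  let: SplitQ _ b1 b2 b3 := b in
  let: SplitQ c0 c1 c2 c3 := c in
  b3 * c2 = b2 * c3 ->
  c0 * (b2 ^+ 2 + b3 ^+ 2) + c2 ^+ 2 + c3 ^+ 2 = 0.

Definition condA b c : Prop :=
  [/\ 0 <= splitq_M b, 0 <= splitq_M c,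
      exists r, condA1 b c r & condA2 b c].

Definition a21 b c r : R :=
  let: SplitQ _ b1 b2 b3 := b in
  let: SplitQ c0 c1 c2 c3 := c in
  (- 2 * r ^+ 2 * b2 - (b1 * b3 + 2 * c2) * r - b1 * c3)
    / (b2 ^+ 2 + b3 ^+ 2).

Definition a22 b r : R :=
  let: SplitQ _ b1 b2 b3 := b in
  (b1 * b2 - 2 * b3 * r) / (b2 ^+ 2 + b3 ^+ 2).

Definition a31 b c r : R :=
  let: SplitQ _ b1 b2 b3 := b in
  let: SplitQ c0 c1 c2 c3 := c in
  (- 2 * r ^+ 2 * b3 + (b1 * b2 - 2 * c3) * r + b1 * c2)
    / (b2 ^+ 2 + b3 ^+ 2).

Definition a32 b r : R :=
  let: SplitQ _ b1 b2 b3 := b in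
  (b1 * b3 + 2 * b2 * r) / (b2 ^+ 2 + b3 ^+ 2).

Definition root_r b c : R :=
  let: SplitQ _ b1 b2 b3 := b in
  let: SplitQ c0 c1 c2 c3 := c in
  (b1 * (b2 * c2 + b3 * c3) - c1 * (b2 ^+ 2 + b3 ^+ 2))
    / (2 * (b2 * c3 - b3 * c2)).

Definition root_x1 b c : R :=
  let: SplitQ _ b1 b2 b3 := b in
  let: SplitQ c0 c1 c2 c3 := c in
  (c0 * (b2 ^+ 2 + b3 ^+ 2) + b1 * (b3 * c2 - b2 * c3) + c2 ^+ 2 + c3 ^+ 2)
    / (2 * (b2 * c3 - b3 * c2)).

Definition root_of b c r (x1 : R) : splitq R :=
  SplitQ r x1 (a21 b c r + a22 b r * x1) (a31 b c r + a32 b r * x1).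

Definition singular_solution b c x : Prop :=
  x ^+ 2 + b * x + c = 0 /\ (2 * sq0 x)%:A + b \in splitq_Z.

End QuadraticEquation.

(* Main.v *)
Require Import Defs.
From HB Require Import structures.
From mathcomp Require Import all_boot all_order all_algebra.
From mathcomp Require Import reals ring lra.

(** Write a solution as x = r + x1 i + x2 j + x3 k and put N = b2^2 + b3^2 and
    D = b3 c2 - b2 c3. The condition 2 r + b in Z reads 4 r^2 + b1^2 = N, and
    N > 0 because b <> 0.

    The j- and k-components of the equation are linear in (x2, x3), and with
    the complex number w = x2 + x3 i they say
      (2 r + b1 i) w = A + B i,
    where A = - (b2 r + b3 x1 + c2) and B = - (b3 r - b2 x1 + c3). Since
    |2 r + b1 i|^2 = N <> 0, they determine w as an affine function of x1, whose
    coefficients are a21, a22, a31 and a32 ([complex_linear_solve]). Substituted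
    into the i-component, multiplied by N, this w makes x1 disappear and leaves
    the equation of [condA1]. In the scalar component |w|^2 occurs, and
    N |w|^2 = A^2 + B^2 makes the terms in x1^2 cancel, leaving
      2 D x1 + (c0 N + b1 D + c2^2 + c3^2) = 0.
    So the quadratic equation is equivalent to [condA1] for r, the formulas for
    x2 and x3, and one affine equation for x1 ([singular_solutionP]).

    If D <> 0, then [condA1] determines r and the affine equation determines
    x1. If D = 0, then x1 is free provided that [condA2] holds, [condA1]
    constrains r only through r^2, and both square roots of M_b / 4 occur.
    The inequality M_c >= 0 is a consequence of [condA1], by the Cauchy-Schwarz
    inequality in the plane ([condA1_Mc_ge0]). *)

Set Implicit Arguments.
Unset Strict Implicit.
Unset Printing Implicit Defensive.

Import Order.TTheory GRing.Theory Num.Theory.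

Local Open Scope ring_scope.

(** The equation (p + q i) (u + v i) = s + t i is solved by multiplying it with
    the conjugate p - q i. *)
Lemma complex_linear_solve (F : fieldType) (p q u v s t n : F) :
  p ^+ 2 + q ^+ 2 = n -> n != 0 ->
  (p * u - q * v = s /\ q * u + p * v = t) <->
  (u = (p * s + q * t) / n /\ v = (p * t - q * s) / n).
Proof.
move=> <- n0; split=> [] [].
  by move=> <- <-; split; field.
by move=> -> ->; split; field.
Qed.

Section SingularSolutions.
Variables (R : realType) (b1 b2 b3 c0 c1 c2 c3 : R).
Let b := SplitQ 0 b1 b2 b3.
Let c := SplitQ c0 c1 c2 c3.
Let N := b2 ^+ 2 + b3 ^+ 2.
Let D := b3 * c2 - b2 * c3.

Lemma singular_solution_coordE (r x1 x2 x3 : R) :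
  singular_solution b c (SplitQ r x1 x2 x3) <->
  [/\ r ^+ 2 - x1 ^+ 2 + x2 ^+ 2 + x3 ^+ 2
        - b1 * x1 + b2 * x2 + b3 * x3 + c0 = 0,
      2 * r * x1 + b1 * r - b2 * x3 + b3 * x2 + c1 = 0,
      2 * r * x2 - b1 * x3 = - (b2 * r + b3 * x1 + c2),
      b1 * x2 + 2 * r * x3 = - (b3 * r - b2 * x1 + c3) &
      (2 * r) ^+ 2 + b1 ^+ 2 = N].
Proof.
rewrite /singular_solution inE /N; split.
  by case=> -[e0 e1 e2 e3] /eqP /= z; split; lra.
case=> e0 e1 e2 e3 z; split; last by apply/eqP => /=; lra.
by congr SplitQ => /=; lra.
Qed.

(** If N = 0, then b = b1 i and M_b = - b1^2 < 0. *)
Lemma splitq_M_ge0_sum_gt0 (hb : b <> 0) : 0 <= splitq_M b -> 0 < N.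
Proof.
rewrite /splitq_M /b /N => hM; rewrite lt0r addr_ge0 ?sqr_ge0 // andbT.
apply/eqP => hN; apply: hb.
have b1_0 : b1 = 0.
  apply/eqP; rewrite -sqrf_eq0 eq_le sqr_ge0 andbT; lra.
move/eqP: hN; rewrite paddr_eq0 ?sqr_ge0 // !sqrf_eq0 => /andP[/eqP h2 /eqP h3].
by rewrite /b b1_0 h2 h3.
Qed.

Lemma condA1_norm (r : R) : condA1 b c r -> (2 * r) ^+ 2 + b1 ^+ 2 = N.
Proof. by case=> + _; rewrite /splitq_M /b /N; lra. Qed.

(** [condA1] says that c1 N is the scalar product of (b1, 2 r), of squared
    length N, with (b2 c2 + b3 c3, D), of squared length N (c2^2 + c3^2). *)
Lemma condA1_Mc_ge0 (r : R) : 0 < N -> condA1 b c r -> 0 <= splitq_M c.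
Proof.
move=> N0 hA; have hN := condA1_norm hA; case: hA => _ hA1.
have c1N : c1 * N = b1 * (b2 * c2 + b3 * c3) + 2 * r * D.
  by rewrite /N /D; lra.
have lagrange : N ^+ 2 * splitq_M c =
    (b1 * D - 2 * r * (b2 * c2 + b3 * c3)) ^+ 2.
  have -> : N ^+ 2 * splitq_M c = N * (N * (c2 ^+ 2 + c3 ^+ 2)) - (c1 * N) ^+ 2.
    by rewrite /splitq_M /c; ring.
  by rewrite c1N -{1}hN /N /D; ring.
by rewrite -(pmulr_rge0 _ (exprn_gt0 2 N0)) lagrange sqr_ge0.
Qed.

(** For fixed r = sq0 x with 4 r^2 + b1^2 = N the equation amounts to a linear
    system in the other coordinates: multiplication by 2 r + b1 i scales |w|^2
    by exactly N, so that A^2 + B^2 = N |w|^2 expresses x2^2 + x3^2 as x1^2 plus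
    affine terms in x1, and this x1^2 cancels the - x1^2 of the scalar
    component. *)
Lemma singular_solutionP (x : splitq R) : N != 0 ->
  singular_solution b c x <->
  [/\ condA1 b c (sq0 x), x = root_of b c (sq0 x) (sq1 x) &
      2 * D * sq1 x + (c0 * N + b1 * D + c2 ^+ 2 + c3 ^+ 2) = 0].
Proof.
move=> N0; case: x => r x1 x2 x3 /=.
rewrite singular_solution_coordE.
set A := - (b2 * r + _ + _); set B := - (b3 * r - _ + _).
set e0 := r ^+ 2 - _ + _ + _ - _ + _ + _ + _; set e1 := 2 * r * x1 + _ - _ + _ + _.
have root2 : (2 * r * A + b1 * B) / N = a21 b c r + a22 b r * x1.
  by rewrite /a21 /a22 /A /B /N /=; field.
have root3 : (2 * r * B - b1 * A) / N = a31 b c r + a32 b r * x1.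
  by rewrite /a31 /a32 /A /B /N /=; field.
(* N e1 and N e0 are the left sides of the two remaining conditions as soon as w
   solves its linear equation, so both directions can be read off from this. *)
have component_eqs : (2 * r) ^+ 2 + b1 ^+ 2 = N ->
    2 * r * x2 - b1 * x3 = A -> b1 * x2 + 2 * r * x3 = B ->
    N * e1 = 2 * (b2 * c3 - b3 * c2) * r - b1 * (b2 * c2 + b3 * c3)
               + c1 * (b2 ^+ 2 + b3 ^+ 2) /\
    N * e0 = 2 * D * x1 + (c0 * N + b1 * D + c2 ^+ 2 + c3 ^+ 2).
  move=> hN hA hB.
  have Nx2 : N * x2 = 2 * r * A + b1 * B by rewrite -hN -hA -hB; ring.
  have Nx3 : N * x3 = 2 * r * B - b1 * A by rewrite -hN -hA -hB; ring.
  have Nw : N * (x2 ^+ 2 + x3 ^+ 2) = A ^+ 2 + B ^+ 2.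
    by rewrite -hN -hA -hB; ring.
  split.
    have -> : N * e1 = N * (2 * r * x1 + b1 * r + c1)
                         + (b3 * (N * x2) - b2 * (N * x3)).
      by rewrite /e1; ring.
    by rewrite Nx2 Nx3 /A /B /N; ring.
  have -> : N * e0 = N * (r ^+ 2 - x1 ^+ 2 - b1 * x1 + c0)
      + N * (x2 ^+ 2 + x3 ^+ 2) + (b2 * (N * x2) + b3 * (N * x3)).
    by rewrite /e0; ring.
  by rewrite Nw Nx2 Nx3 /A /B /N /D; ring.
split.
  case=> h0 h1 hA hB hN; have [E1 E0] := component_eqs hN hA hB.
  have [x2E x3E] := (complex_linear_solve x2 x3 A B hN N0).1 (conj hA hB).
  split; last by rewrite -E0 h0 mulr0.
  - split; last by rewrite -E1 h1 mulr0.
    by move: hN; rewrite /N /splitq_M /b; lra.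
  - by rewrite /root_of -root2 -root3 -x2E -x3E.
case=> hA1 [x2E x3E] lin; have hN := condA1_norm hA1.
rewrite -root2 in x2E; rewrite -root3 in x3E.
have [hA hB] := (complex_linear_solve x2 x3 A B hN N0).2 (conj x2E x3E).
have [E1 E0] := component_eqs hN hA hB; split=> //.
  by apply: (mulfI N0); rewrite mulr0 E0.
by apply: (mulfI N0); rewrite mulr0 E1; case: hA1.
Qed.

Lemma singular_solution_Mb_ge0 (x : splitq R) :
  singular_solution b c x -> 0 <= splitq_M b.
Proof.
case: x => r x1 x2 x3 /singular_solution_coordE [_ _ _ _].
by rewrite /splitq_M /b /N; have := sqr_ge0 r; lra.
Qed.

Lemma denominator_neq0 : D != 0 -> 2 * (b2 * c3 - b3 * c2) != 0.
Proof. by move=> D0; rewrite mulf_neq0 ?pnatr_eq0 // -opprB oppr_eq0. Qed.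

Lemma condA1_root_r (r : R) : D != 0 -> condA1 b c r -> r = root_r b c.
Proof.
move=> D0 [_ hA1].
have D0' := denominator_neq0 D0.
apply: (mulIf D0'); rewrite /root_r /b /c divfK //; lra.
Qed.

Lemma root_x1P (x1 : R) : D != 0 ->
  2 * D * x1 + (c0 * N + b1 * D + c2 ^+ 2 + c3 ^+ 2) = 0 <-> x1 = root_x1 b c.
Proof.
move=> D0.
have D0' := denominator_neq0 D0.
have -> : root_x1 b c =
    (c0 * N + b1 * D + c2 ^+ 2 + c3 ^+ 2) / (2 * (b2 * c3 - b3 * c2)) by [].
split=> [h|->].
  by apply: (mulIf D0'); rewrite divfK // /D in h *; lra.
apply/eqP; rewrite addr_eq0; apply/eqP.
by rewrite -[RHS]mulN1r -[X in _ = _ * X](divfK D0') /D; ring.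
Qed.

Lemma condA1_degenerate (r : R) : D = 0 ->
  condA1 b c r <->
  r ^+ 2 = splitq_M b / 4 /\ c1 * N = b1 * (b2 * c2 + b3 * c3).
Proof.
move=> D0; have E : b2 * c3 - b3 * c2 = 0 by rewrite -opprB -/D D0 oppr0.
by rewrite /condA1 /b /c E -/b -/N; split=> -[-> h]; split=> //; lra.
Qed.

End SingularSolutions.

Lemma sqr_eq_quarterP (R : realType) (m s : R) : 0 <= m ->
  s ^+ 2 = m / 4 <-> s = Num.sqrt m / 2 \/ s = - (Num.sqrt m / 2).
Proof.
move=> m0; have -> : m / 4 = (Num.sqrt m / 2) ^+ 2.
  by rewrite exprMn sqr_sqrtr // exprVn; congr (_ / _); ring.
split=> [/eqP|]; first by rewrite eqf_sqr => /orP[]/eqP; [left | right].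
by case=> ->; rewrite ?sqrrN.
Qed.

Theorem theorem3p1 (R : realType) (b1 b2 b3 c0 c1 c2 c3 : R) :
  let b := SplitQ 0 b1 b2 b3 in
  let c := SplitQ c0 c1 c2 c3 in
  b <> 0 ->
  ((exists x : splitq R, singular_solution b c x) <-> condA b c) /\
  (condA b c -> forall r : R, condA1 b c r ->
    (b3 * c2 - b2 * c3 <> 0 ->
       r = root_r b c /\
       (forall x : splitq R,
          singular_solution b c x <-> x = root_of b c r (root_x1 b c))) /\
    (b3 * c2 - b2 * c3 = 0 ->
       forall x : splitq R,
         singular_solution b c x <->
         exists s x1 : R,
           (s = Num.sqrt (splitq_M b) / 2 \/ s = - (Num.sqrt (splitq_M b) / 2))
           /\ x = root_of b c s x1)).
Proof.
move=> b c b_neq0.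
have N_gt0 := splitq_M_ge0_sum_gt0 b_neq0.
have solP x (hM : 0 <= splitq_M b) :=
  singular_solutionP b1 c0 c1 c2 c3 x (lt0r_neq0 (N_gt0 hM)).
split.
  split.
    case=> x sol; have hM := singular_solution_Mb_ge0 sol.
    have [hA1 _ lin] := (solP x hM).1 sol.
    split=> //; first exact: condA1_Mc_ge0 (N_gt0 hM) hA1.
      by exists (sq0 x).
    move=> /eqP; rewrite -subr_eq0 => /eqP D0.
    by move: lin; rewrite D0; lra.
  case=> hM _ [r hA1] hA2.
  have [D0|D0] := eqVneq (b3 * c2 - b2 * c3) 0.
    (* x1 is arbitrary in this case *)
    exists (root_of b c r 0); apply/(solP _ hM); split=> //=.
    have /hA2 : b3 * c2 = b2 * c3 by apply/eqP; rewrite -subr_eq0 D0.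
    by rewrite D0; lra.
  exists (root_of b c r (root_x1 b c)); apply/(solP _ hM); split=> //=.
  exact/(root_x1P b1 c0 c1 _ D0).
case=> hM _ _ hA2 r hA1; split=> [/eqP D0|D0 x].
  split; first exact: condA1_root_r hA1.
  move=> x; rewrite (solP x hM); split=> [[hA1' -> lin]|->].
    rewrite (condA1_root_r D0 hA1) -(condA1_root_r D0 hA1').
    by congr root_of; apply/(root_x1P b1 c0 c1 _ D0).
  by split=> //=; apply/(root_x1P b1 c0 c1 _ D0).
have /hA2 sing : b3 * c2 = b2 * c3 by apply/eqP; rewrite -subr_eq0 D0.
have [_ c1N] := (condA1_degenerate b1 c0 c1 r D0).1 hA1.
rewrite (solP x hM); split=> [[hA1' xE _]|[s [x1 [sE ->]]]].
  exists (sq0 x), (sq1 x); split=> //.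
  by apply/(sqr_eq_quarterP _ hM); case: hA1'.
split=> //=; last by rewrite D0; lra.
by apply/condA1_degenerate => //; split=> //; apply/sqr_eq_quarterP.
Qed.
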